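(* Let $n$ be a positive integer and let $f$ be a real-valued function on $[0,1]$. Then the limit $\boldsymbol{F}_n^{(\infty)}=\lim_{k\to\infty}\boldsymbol{F}_n^{(k)}$ exists and $$\boldsymbol{F}_n^{(\infty)}=\lim_{k\to\infty}\boldsymbol{F}_n^{(k)}=\boldsymbol{F}_n^{(1)}\mathfrak{B}_n^{-1}.$$ Consequently the ''optimal'' Bernstein polynomial approximation of degree $n$ of $f$, $\mathbb{B}_n^{(\infty)}f(t)=\boldsymbol{F}_n^{(\infty)}\boldsymbol{B}_n(t)$, is $$\mathbb{B}_n^{(\infty)}f(t)=\boldsymbol{F}_n^{(\infty)}\boldsymbol{B}_n(t)=\boldsymbol{F}_n^{(1)}\mathfrak{B}_n^{-1}\boldsymbol{B}_n(t),\qquad 0\le t\le 1.$$ Moreover, $\mathbb{B}_n^{(\infty)}$ preserves linear functions, i.e. $\mathbb{B}_n^{(\infty)}f=f$ on $[0,1]$ whenever $f(t)=a+bt$ with $a,b\in\mathbb{R}$.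
   Context: For a positive integer $n$ let $B_{ni}(t)=\binom{n}{i}t^i(1-t)^{n-i}$, $i=0,\ldots,n$, and for a function $f$ on $[0,1]$ let $\mathbb{B}_nf(t)=\sum_{i=0}^n f(i/n)B_{ni}(t)$, $0\le t\le1$. The iterated Bernstein polynomials of degree $n$ are defined by $\mathbb{B}_n^{(1)}f=\mathbb{B}_nf$ and, for $k\ge1$, $\mathbb{B}_n^{(k+1)}f=\mathbb{B}_n^{(k)}f-\mathbb{B}_n\{\mathbb{B}_n^{(k)}f-f\}$. Let $\boldsymbol{B}_n(t)=(B_{n0}(t),\ldots,B_{nn}(t))^{T}$ (column vector). For each $k\ge1$, $\boldsymbol{F}_n^{(k)}$ denotes the row vector in $\mathbb{R}^{n+1}$ of coefficients of $\mathbb{B}_n^{(k)}f$ in the Bernstein basis, i.e. $\mathbb{B}_n^{(k)}f(t)=\boldsymbol{F}_n^{(k)}\boldsymbol{B}_n(t)$; in particular $\boldsymbol{F}_n^{(1)}=(f(0/n),f(1/n),\ldots,f(n/n))$. The $(n+1)\times(n+1)$ matrix $\mathfrak{B}_n=(b_{ij})$ is given by $b_{ij}=B_{n,i-1}\left(\frac{j-1}{n}\right)$, $i,j=1,\ldots,n+1$; it is nonsingular. *)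

(* Defs.v *)
From HB Require Import structures.
From mathcomp Require Import all_boot all_order all_algebra.
From mathcomp Require Import all_classical all_reals all_analysis.
From mathcomp Require Import zify.

Set Implicit Arguments.
Unset Strict Implicit.
Unset Printing Implicit Defensive.

Import Order.TTheory GRing.Theory Num.Theory.
Import numFieldNormedType.Exports.
Local Open Scope classical_set_scope.
Local Open Scope ring_scope.

(* A function on [0, 1] is represented by a total f : R -> R; only its values
   at the nodes i/n are ever used by the operators below. *)

Definition bernstein_basis (R : realType) (n i : nat) (t : R) : R :=
  'C(n, i)%:R * t ^+ i * (1 - t) ^+ (n - i).

Definition bernstein (R : realType) (n : nat) (f : R -> R) (t : R) : R :=
  \sum_(i < n.+1) f (i%:R / n%:R) * bernstein_basis n i t.

(* The iterates are indexed from 1; the value at k = 0 is a placeholder. *)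
Fixpoint iter_bernstein (R : realType) (n : nat) (f : R -> R) (k : nat)
    {struct k} : R -> R :=
  match k with
  | 0 => fun=> 0
  | 1 => bernstein n f
  | k'.+1 => fun t => iter_bernstein n f k' t
      - bernstein n (fun s => iter_bernstein n f k' s - f s) t
  end.

Definition bernstein_vec (R : realType) (n : nat) (t : R) : 'cV[R]_n.+1 :=
  \col_(i < n.+1) bernstein_basis n i t.

(* [F *m bernstein_vec n t] is a 1 x 1 matrix, hence the [0 0]. *)
Definition bernstein_comb (R : realType) (n : nat) (F : 'rV[R]_n.+1) (t : R) : R
  := (F *m bernstein_vec n t) 0 0.

Definition is_bernstein_coef (R : realType) (n : nat) (g : R -> R)
    (F : 'rV[R]_n.+1) : Prop :=
  forall t : R, 0 <= t <= 1 -> g t = bernstein_comb F t.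

(* The coefficient vector of the k-th iterate; it exists and is unique for
   n > 0, see [bernstein_coefP] and [is_bernstein_coef_inj]. *)
Definition bernstein_coef (R : realType) (n : nat) (f : R -> R) (k : nat) :
    'rV[R]_n.+1 :=
  xget 0 [set F | is_bernstein_coef (iter_bernstein n f k) F].

(* Indices start at 0, so the entry (i, j) is B_{n,i}(j/n). *)
Definition bernstein_mx (R : realType) (n : nat) : 'M[R]_n.+1 :=
  \matrix_(i < n.+1, j < n.+1) bernstein_basis n i (j%:R / n%:R).

Definition bernstein_coef_lim (R : realType) (n : nat) (f : R -> R) :
    'rV[R]_n.+1 :=
  limn (bernstein_coef n f).

Definition opt_bernstein (R : realType) (n : nat) (f : R -> R) (t : R) : R :=
  bernstein_comb (bernstein_coef_lim n f) t.

Section WellDefined.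
Variables (R : realType) (n : nat).
Implicit Types (F G : 'rV[R]_n.+1) (f : R -> R).

Lemma bernstein_combE F t :
  bernstein_comb F t = \sum_(i < n.+1) F 0 i * bernstein_basis n i t.
Proof. by rewrite /bernstein_comb mxE; apply: eq_bigr => i _; rewrite mxE. Qed.

Lemma bernstein_combB F G t :
  bernstein_comb (F - G) t = bernstein_comb F t - bernstein_comb G t.
Proof.
rewrite !bernstein_combE -sumrB.
by apply: eq_bigr => i _; rewrite !mxE mulrBl.
Qed.

Lemma bernstein_mulmx F (j : 'I_n.+1) :
  (F *m bernstein_mx R n) 0 j = bernstein_comb F (j%:R / n%:R).
Proof.
by rewrite bernstein_combE mxE; apply: eq_bigr => i _; rewrite mxE.
Qed.

Lemma bernstein_sample f :
  bernstein n f = bernstein_comb (\row_(j < n.+1) f (j%:R / n%:R)).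
Proof.
apply/funext => t; rewrite bernstein_combE.
by apply: eq_bigr => i _; rewrite mxE.
Qed.

Lemma bernstein_comb_nodes_eq0 F : (0 < n)%N ->
  (forall j : 'I_n.+1, bernstein_comb F (j%:R / n%:R) = 0) -> F = 0.
Proof.
move=> n0 F0.
have nn0 : n%:R != 0 :> R by rewrite pnatr_eq0 -lt0n.
have Fn : F 0 ord_max = 0.
  have := F0 ord_max; rewrite bernstein_combE divff// big_ord_recr/=.
  rewrite big1 => [|i _].
    by rewrite add0r /bernstein_basis binn subnn expr1n !mulr1.
  by rewrite /bernstein_basis subrr expr0n subn_eq0 leqNgt ltn_ord !mulr0.
pose q := \poly_(i < n) (F 0 (inord i) * 'C(n, i)%:R).
pose u (j : nat) : R := j%:R / (n - j)%:R.
have q0 : q = 0.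
  apply/eqP; apply: contraT => qN0.
  have : (size [seq u j | j <- iota 0 n] < size q)%N.
    apply: max_poly_roots => //.
      apply/allP => x /mapP[j]; rewrite mem_iota add0n => /andP[_ jn] ->.
      have njN0 : (n - j)%:R != 0 :> R.
        by rewrite pnatr_eq0 subn_eq0 -ltnNge.
      have jE : 1 - j%:R / n%:R = (n - j)%:R / n%:R :> R.
        by rewrite natrB ?(ltnW jn)// mulrBl divff.
      have := F0 (Ordinal (ltnW jn : (j < n.+1)%N)).
      rewrite bernstein_combE big_ord_recr/= Fn mul0r addr0 => H.
      rewrite rootE horner_poly.
      have C0 : ((n - j)%:R / n%:R) ^+ n != 0 :> R.
        by rewrite expf_neq0// mulf_neq0// invr_eq0.
      apply/eqP/(mulIf C0); rewrite mul0r -[RHS]H mulr_suml.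
      apply: eq_bigr => i _; rewrite /bernstein_basis jE /u.
      have -> : inord i = widen_ord (leqnSn n) i.
        by apply: val_inj; rewrite /= inordK// ltnS ltnW.
      have -> : ((n - j)%:R / n%:R) ^+ n =
          ((n - j)%:R / n%:R) ^+ (n - i) * ((n - j)%:R / n%:R) ^+ i :> R.
        by rewrite -exprD subnK// ltnW.
      have -> : j%:R / n%:R = j%:R / (n - j)%:R * ((n - j)%:R / n%:R) :> R.
        by rewrite mulrA divfK.
      rewrite [in RHS]exprMn.
      by rewrite -!mulrA; congr (_ * (_ * (_ * _))); rewrite mulrC.
    rewrite map_inj_in_uniq ?iota_uniq// => i j.
    rewrite !mem_iota !add0n => /andP[_ ilt] /andP[_ jlt] /eqP.
    rewrite /u eqr_div ?pnatr_eq0 ?subn_eq0 -?ltnNge//.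
    rewrite -!natrM eqr_nat !mulnBr mulnC [(j * i)%N]mulnC => /eqP /eqP.
    move=> /eqP H; have : (i * n = j * n)%N.
      have i1 : (i * j <= n * i)%N by rewrite mulnC leq_mul2r (ltnW jlt) orbT.
      have i2 : (i * j <= j * n)%N by rewrite mulnC leq_mul2l (ltnW ilt) orbT.
      lia.
    by move/eqP; rewrite eqn_pmul2r// => /eqP.
  by rewrite size_map size_iota ltnNge size_poly.
apply/rowP => i; rewrite mxE.
have [il|] := ltnP i n; last first.
  move=> ni; rewrite -Fn; congr (F 0 _); apply: val_inj => /=.
  by apply/eqP; rewrite eqn_leq ni -ltnS ltn_ord.
have := congr1 (fun p : {poly R} => p`_i) q0; rewrite coef_poly il coef0 inord_val.
move/eqP; rewrite mulf_eq0 => /orP[/eqP//|].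
by rewrite pnatr_eq0 -leqn0 leqNgt bin_gt0 (ltnW il).
Qed.

Lemma bernstein_mx_unit : (0 < n)%N -> bernstein_mx R n \in unitmx.
Proof.
move=> n0; rewrite -row_free_unit -kermx_eq0; apply/rowV0P => v.
move=> /sub_kermxP vB; apply: bernstein_comb_nodes_eq0 => // j.
by rewrite -bernstein_mulmx vB mxE.
Qed.

Lemma is_bernstein_coef_inj (g : R -> R) F G : (0 < n)%N ->
  is_bernstein_coef g F -> is_bernstein_coef g G -> F = G.
Proof.
move=> n0 gF gG; apply/eqP; rewrite -subr_eq0; apply/eqP.
apply: bernstein_comb_nodes_eq0 => // j.
have j01 : 0 <= (j%:R / n%:R : R) <= 1.
  by rewrite divr_ge0//= ler_pdivrMr ?ltr0n// mul1r ler_nat -ltnS.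
by rewrite bernstein_combB -gF// -gG// subrr.
Qed.

Lemma bernstein_coefP f k :
  is_bernstein_coef (iter_bernstein n f k) (bernstein_coef n f k).
Proof.
suff [F HF] : exists F, iter_bernstein n f k = bernstein_comb F.
  by apply: (xgetPex 0); exists F => t _; rewrite HF.
elim: k => [|[|k] [F IH]].
- by exists 0; apply/funext => t; rewrite /bernstein_comb mul0mx mxE.
- by eexists; exact: bernstein_sample.
- exists (F - \row_(j < n.+1) (iter_bernstein n f k.+1 (j%:R / n%:R)
                               - f (j%:R / n%:R))).
  apply/funext => t.
  transitivity (iter_bernstein n f k.+1 t
      - bernstein n (fun s => iter_bernstein n f k.+1 s - f s) t) => //.
  by rewrite bernstein_sample bernstein_combB {1}IH.
Qed.

Lemma bernstein_coef1 f : (0 < n)%N ->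
  bernstein_coef n f 1 = \row_(j < n.+1) f (j%:R / n%:R).
Proof.
move=> n0; apply: (is_bernstein_coef_inj n0 (bernstein_coefP f 1)) => t _.
by rewrite -bernstein_sample.
Qed.

End WellDefined.

(* Main.v *)
Require Import Defs.
From mathcomp Require Import all_boot all_order all_algebra.
From mathcomp Require Import all_classical all_reals all_analysis.
From mathcomp Require Import ring lra zify.
Import Order.TTheory GRing.Theory Num.Theory.
Import numFieldNormedType.Exports.
Local Open Scope classical_set_scope.
Local Open Scope ring_scope.

(** Write B for the matrix of Bernstein basis values at the nodes j/n and A for
    1 - B.  Applying the Bernstein operator to a combination of basis polynomials
    amounts to sampling it at the nodes, that is, to multiplying its coefficient
    row on the right by B.  The iteration therefore reads F_(k+1) = F_k A + F_1
    on coefficient rows; its fixed point is G = F_1 B^-1 and the error is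
    F_(k+1) - G = (F_1 - G) A^k ([bernstein_coef_error]).  Everything rests on
    v A^k --> 0 for every row v ([sub_bernstein_pow_cvg0]).

    B is triangular with respect to degree.  Let s(p) be the row of samples of a
    polynomial p at the nodes and let Q_d = prod_(i < d) (X - i/n).  Then
    s(Q_d) B = l_d s(X^d), where l_d = n (n-1) ... (n-d+1) / n^d
    ([node_row_newton_mul]): this is the absorption identity for binomial
    coefficients followed by the binomial theorem.  Since Q_d and X^d are monic
    of the same degree, s(Q_d) A = (1 - l_d) s(Q_d) + l_d s(r) with r of degree
    less than d.  As 0 < l_d <= 1 for d <= n, the factor 1 - l_d lies in [0, 1),
    so s(Q_d) A^k obeys a contracting recurrence whose perturbation l_d s(r) A^k
    vanishes by induction on the degree; hence s(p) A^k --> 0 for every p of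
    degree at most n ([node_row_pow_cvg0]).  Every row is such an s(p): it is
    v = (v B^-1) B, the samples of the Bernstein combination with coefficients
    v B^-1.

    Affine functions are preserved because l_0 = l_1 = 1: the samples of a + bX
    form a row fixed by B, hence by B^-1, and the Bernstein combination with
    these coefficients is a + bX itself ([bernstein_comb_affine]). *)

Set Implicit Arguments.
Unset Strict Implicit.

(** Once y is within (1 - mu) e/2, the bound mu^m |x_N| + e/2 reproduces itself
    under the recurrence, and its first term tends to 0. *)
Lemma cvg_contraction_perturbed (R : realType) (V : normedModType R) (mu : R)
    (x y : nat -> V) :
  0 <= mu < 1 -> (forall k, x k.+1 = mu *: x k + y k) ->
  y @ \oo --> 0 -> x @ \oo --> 0.
Proof.
move=> /andP[mu0 mu1] xS y0; apply/cvgr0Pnorm_le => e e0.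
have d0 : 0 < e / 2 * (1 - mu) by rewrite mulr_gt0 ?divr_gt0 ?subr_gt0.
move: y0 => /cvgr0Pnorm_le /(_ _ d0) [N _ yN].
have xN m : `|x (N + m)%N| <= mu ^+ m * `|x N| + e / 2.
  elim: m => [|m IH]; first by rewrite addn0 expr0 mul1r lerDl divr_ge0// ltW.
  rewrite addnS xS (le_trans (ler_normD _ _))// normrZ (ger0_norm mu0).
  have yNm : `|y (N + m)%N| <= e / 2 * (1 - mu) by apply: yN; rewrite /= leq_addr.
  have muIH := ler_wpM2l mu0 IH.
  by rewrite exprS; lra.
have mux0 : (fun m => mu ^+ m * `|x N|) @ \oo --> (0 : R).
  rewrite -[X in _ --> X](mul0r `|x N|); apply: cvgMl.
  by apply: cvg_expr; rewrite ger0_norm.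
move: mux0 => /cvgr0Pnorm_le /(_ _ (divr_gt0 e0 (ltr0Sn R 1))) [M _ muM].
exists (N + M)%N => // k /= NMk.
have Nk : (N <= k)%N by apply: leq_trans NMk; rewrite leq_addr.
have := xN (k - N)%N; rewrite subnKC// => /le_trans; apply.
have := muM (k - N)%N; rewrite /= leq_subRL// => /(_ NMk) /ler_normlW.
by lra.
Qed.

(** * Newton polynomials sampled at the nodes *)

Definition node (R : realType) (n i : nat) : R := i%:R / n%:R.

Definition node_row (R : realType) (n : nat) (p : {poly R}) : 'rV[R]_n.+1 :=
  \row_(j < n.+1) p.[node R n j].

(** The Newton basis at the nodes: at i/n it takes the value i^_d / n^d, and a
    falling factorial absorbs into a binomial coefficient. *)
Definition newton_poly (R : realType) (n d : nat) : {poly R} :=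
  \prod_(0 <= i < d) ('X - (node R n i)%:P).

(** The diagonal entries of the Bernstein operator in any basis of polynomials
    graded by degree. *)
Definition bernstein_eigenvalue (R : realType) (n d : nat) : R :=
  (n ^_ d)%:R / n%:R ^+ d.

Lemma ffact_mul_bin (n i d : nat) : (i <= n)%N -> (d <= i)%N ->
  (i ^_ d * 'C(n, i) = n ^_ d * 'C(n - d, i - d))%N.
Proof.
move=> le_in le_di; have le_dn := leq_trans le_di le_in.
have pos : (0 < (i - d)`! * (n - i)`!)%N by rewrite muln_gt0 !fact_gt0.
apply/eqP; rewrite -(eqn_pmul2r pos); apply/eqP.
have e1 := ffact_fact le_di; have e2 := ffact_fact le_dn.
have e3 := bin_fact le_in; have e4 := bin_fact (leq_sub2r d le_in).
have e5 : (n - d - (i - d) = n - i)%N by rewrite subnBA// subnK.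
rewrite e5 in e4.
transitivity n`!; first by rewrite -e3 -e1; nia.
by rewrite -e2 -e4; nia.
Qed.

Section NewtonBasis.
Variables (R : realType) (n : nat).
Hypothesis n_gt0 : (0 < n)%N.

Let nN0 : n%:R != 0 :> R. Proof. by rewrite pnatr_eq0 -lt0n. Qed.

Lemma size_newton_poly d : size (newton_poly R n d) = d.+1.
Proof. by rewrite /newton_poly size_prod_XsubC size_iota subn0. Qed.

Lemma newton_poly_monic d : newton_poly R n d \is monic.
Proof. exact: monic_prod_XsubC. Qed.

Lemma newton_poly_node d i :
  (newton_poly R n d).[node R n i] = (i ^_ d)%:R / n%:R ^+ d.
Proof.
rewrite /newton_poly horner_prod; elim: d => [|d IH].
  by rewrite big_nil ffactn0 expr0 divr1.
rewrite big_nat_recr //= IH hornerXsubC ffactnSr natrM exprSr.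
have [le_di|lt_id] := leqP d i.
  by rewrite natrB// /node -mulrBl invfM mulrACA.
by rewrite ffact_small// !mul0r.
Qed.

(** By absorption, i^_d 'C(n, i) = n^_d 'C(n - d, i - d), so after factoring out
    n^_d / n^d t^d what remains is the binomial expansion of (1 - t + t)^(n - d). *)
Lemma bernstein_comb_newton d t : (d <= n)%N ->
  bernstein_comb (node_row n (newton_poly R n d)) t
    = bernstein_eigenvalue R n d * t ^+ d.
Proof.
move=> le_dn; pose c i : R := (i ^_ d)%:R / n%:R ^+ d * bernstein_basis n i t.
rewrite bernstein_combE.
transitivity (\sum_(0 <= i < n.+1) c i).
  by rewrite big_mkord; apply: eq_bigr => i _; rewrite mxE newton_poly_node.
rewrite (big_cat_nat (n := d)) ?leqW//=.
rewrite big_nat big1 ?add0r => [|i /andP[_ lt_id]]; last first.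
  by rewrite /c ffact_small// !mul0r.
rewrite -{1}[d]add0n big_addn subSn// big_mkord.
transitivity (bernstein_eigenvalue R n d * t ^+ d * (1 - t + t) ^+ (n - d)).
  rewrite exprDn mulr_sumr; apply: eq_bigr => i _.
  have le_in : (i + d <= n)%N by have := ltn_ord i; lia.
  have := ffact_mul_bin le_in (leq_addl i d); rewrite addnK.
  move/(congr1 (fun m : nat => m%:R : R)); rewrite !natrM => bin_i.
  rewrite /c /bernstein_eigenvalue /bernstein_basis -mulr_natr.
  have -> : (n - (i + d) = n - d - i)%N by lia.
  rewrite exprD mulrACA.
  transitivity (((i + d) ^_ d)%:R * 'C(n, i + d)%:R / n%:R ^+ d
    * (t ^+ i * t ^+ d * (1 - t) ^+ (n - d - i)) : R); first by ring.
  by rewrite bin_i; ring.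
by rewrite subrK expr1n mulr1.
Qed.

(** The triangular action of the Bernstein matrix: the image of the d-th Newton
    polynomial has the same degree, with leading coefficient scaled by the
    eigenvalue. *)
Lemma node_row_newton_mul d : (d <= n)%N ->
  node_row n (newton_poly R n d) *m bernstein_mx R n
    = bernstein_eigenvalue R n d *: node_row n 'X^d.
Proof.
move=> le_dn; apply/rowP => j.
by rewrite bernstein_mulmx bernstein_comb_newton// !mxE hornerXn.
Qed.

Lemma bernstein_eigenvalue_itv d : (d <= n)%N ->
  0 < bernstein_eigenvalue R n d <= 1.
Proof.
move=> le_dn; rewrite /bernstein_eigenvalue -natrX.
rewrite divr_gt0 ?ltr0n ?ffact_gt0 ?expn_gt0 ?n_gt0//=.
rewrite ler_pdivrMr ?ltr0n ?expn_gt0 ?n_gt0// mul1r ler_nat.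
elim: d {le_dn} => // d IH; rewrite ffactnSr expnSr.
by rewrite leq_mul// leq_subr.
Qed.

Lemma node_rowB p q :
  node_row n (p - q) = node_row n p - node_row n q :> 'rV[R]_n.+1.
Proof. by apply/rowP => j; rewrite !mxE hornerD hornerN. Qed.

Lemma node_rowZ c p : node_row n (c *: p) = c *: node_row n p :> 'rV[R]_n.+1.
Proof. by apply/rowP => j; rewrite !mxE hornerZ. Qed.

(** * Powers of 1 - B tend to 0 *)

Lemma size_sub_monic (p q : {poly R}) d : p \is monic -> q \is monic ->
  size p = d.+1 -> size q = d.+1 -> (size (p - q)%R <= d)%N.
Proof.
move=> /monicP lp /monicP lq sp sq; apply/leq_sizeP => i.
rewrite leq_eqVlt coefB => /orP[/eqP <-|lt_di].
  by move: lp lq; rewrite !lead_coefE sp sq /= => -> ->; rewrite subrr.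
by rewrite !nth_default ?sp ?sq// subrr.
Qed.

(** Induction on the degree bound: the leading Newton term is contracted by
    1 - l_d up to a perturbation of smaller degree, and subtracting the right
    multiple of it from p leaves a polynomial of smaller degree. *)
Lemma node_row_pow_cvg0 d (p : {poly R}) : (d <= n.+1)%N -> (size p <= d)%N ->
  (fun k => node_row n p *m (1 - bernstein_mx R n) ^+ k) @ \oo --> (0 : 'rV[R]_n.+1).
Proof.
elim: d p => [|d IH] p le_dn.
  rewrite leqn0 size_poly_eq0 => /eqP ->.
  have -> : node_row n 0 = 0 :> 'rV[R]_n.+1.
    by apply/rowP => j; rewrite !mxE horner0.
  by under eq_fun do rewrite mul0mx; exact: cvg_cst.
move=> size_p; set A := 1 - bernstein_mx R n in IH *.
set N := newton_poly R n d; set l := bernstein_eigenvalue R n d.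
have N_cvg : (fun k => node_row n N *m A ^+ k) @ \oo --> (0 : 'rV[R]_n.+1).
  have /andP[l0 l1] := bernstein_eigenvalue_itv le_dn.
  apply: (@cvg_contraction_perturbed _ _ (1 - l) _
    (fun k => l *: (node_row n (N - 'X^d) *m A ^+ k))).
  - by rewrite subr_ge0 l1 ltrBlDr ltrDl.
  - move=> k; rewrite exprS mulmxA !scalemxAl -mulmxDl; congr (_ *m _).
    rewrite /A mulmxBr mulmx1 node_row_newton_mul// node_rowB.
    by rewrite scalerBl scalerBr scale1r addrA subrK.
  - rewrite -(scaler0 _ l); apply: cvgZl_tmp.
    apply: IH; first exact: ltnW.
    apply: size_sub_monic; rewrite ?newton_poly_monic ?monicXn//.
    + exact: size_newton_poly.
    + by rewrite size_polyXn.
have rest_size : (size (p - p`_d *: N)%R <= d)%N.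
  apply/leq_sizeP => i; rewrite leq_eqVlt coefB coefZ => /orP[/eqP <-|lt_di].
    have /monicP := newton_poly_monic d.
    by rewrite lead_coefE size_newton_poly /= => ->; rewrite mulr1 subrr.
  rewrite [p`_i]nth_default; last exact: leq_trans lt_di.
  by rewrite [N`_i]nth_default ?size_newton_poly// mulr0 subrr.
have splitting k : node_row n p *m A ^+ k =
    node_row n (p - p`_d *: N) *m A ^+ k + p`_d *: (node_row n N *m A ^+ k).
  by rewrite scalemxAl -node_rowZ -mulmxDl node_rowB subrK.
rewrite (eq_cvg _ _ splitting).
have := cvgD (IH _ (ltnW le_dn) rest_size) (cvgZl_tmp (k := p`_d) N_cvg).
by rewrite scaler0 addr0; apply.
Qed.

Lemma bernstein_comb_poly (F : 'rV[R]_n.+1) :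
  exists2 p : {poly R}, (size p <= n.+1)%N & forall t, bernstein_comb F t = p.[t].
Proof.
exists (\sum_(i < n.+1) (F 0 i * 'C(n, i)%:R) *: ('X^i * (1 - 'X) ^+ (n - i))).
  apply: leq_trans (size_sum _ _ _) _; apply/bigmax_leqP => i _.
  apply: leq_trans (size_scale_leq _ _) _.
  apply: leq_trans (size_polyMleq _ _) _; rewrite size_polyXn /=.
  have s1X : (size (1 - 'X : {poly R})%R <= 2)%N.
    by rewrite (leq_trans (size_polyD _ _))// size_polyN size_polyX size_poly1.
  have size_pow : (size ((1 - 'X) ^+ (n - i) : {poly R})%R <= (n - i).+1)%N.
    rewrite (leq_trans (size_poly_exp_leq _ _))// ltnS -[leqRHS]mul1n.
    by rewrite leq_mul2r -subn1 leq_subLR s1X orbT.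
  rewrite (leq_trans (leq_add (leqnn i) size_pow))// addnS subnKC//.
  by rewrite -ltnS ltn_ord.
move=> t; rewrite bernstein_combE horner_sum; apply: eq_bigr => i _.
by rewrite /bernstein_basis !hornerE.
Qed.

(** Invertibility of the Bernstein matrix provides a polynomial of degree at most
    n with prescribed samples v: the Bernstein combination with coefficients
    v B^-1.  This replaces an interpolation formula. *)
Lemma sub_bernstein_pow_cvg0 (v : 'rV[R]_n.+1) :
  (fun k => v *m (1 - bernstein_mx R n) ^+ k) @ \oo --> (0 : 'rV[R]_n.+1).
Proof.
have [p size_p comb_p] := bernstein_comb_poly (v *m invmx (bernstein_mx R n)).
have -> : v = node_row n p.
  apply/rowP => j; rewrite mxE -comb_p -bernstein_mulmx mulmxKV//.
  exact: bernstein_mx_unit.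
exact: node_row_pow_cvg0 size_p.
Qed.

(** * The coefficients of the iterates *)

(** On coefficients, the operator samples its argument at the nodes, so the
    iteration is affine with linear part 1 - B. *)
Lemma bernstein_coefSS f k : bernstein_coef n f k.+2 =
  bernstein_coef n f k.+1 *m (1 - bernstein_mx R n) + bernstein_coef n f 1.
Proof.
apply: (is_bernstein_coef_inj n_gt0 (bernstein_coefP n f k.+2)) => t t01.
transitivity (iter_bernstein n f k.+1 t
    - bernstein n (fun s => iter_bernstein n f k.+1 s - f s) t) => //.
rewrite bernstein_sample (bernstein_coefP n f k.+1 t01) -bernstein_combB.
congr (bernstein_comb _ t); rewrite mulmxBr mulmx1 -addrA; congr (_ + _).
rewrite bernstein_coef1//; apply/rowP => j.
have j01 : 0 <= (j%:R / n%:R : R) <= 1.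
  by rewrite divr_ge0//= ler_pdivrMr ?ltr0n// mul1r ler_nat -ltnS.
rewrite [LHS]mxE [in LHS]mxE (bernstein_coefP n f k.+1 j01) -bernstein_mulmx.
by rewrite !mxE opprB addrC.
Qed.

(** G is the fixed point of the affine iteration, since G B = F_1. *)
Lemma bernstein_coef_error f k :
  let G := bernstein_coef n f 1 *m invmx (bernstein_mx R n) in
  bernstein_coef n f k.+1
    = G + (bernstein_coef n f 1 - G) *m (1 - bernstein_mx R n) ^+ k.
Proof.
move=> G; elim: k => [|k IH]; first by rewrite expr0 mulmx1 addrC subrK.
rewrite bernstein_coefSS {1}IH mulmxDl exprSr mulmxA addrAC; congr (_ + _).
by rewrite mulmxBr mulmx1 /G mulmxKV ?bernstein_mx_unit// subrK.
Qed.

Lemma bernstein_coef_cvg f : bernstein_coef n f @ \oo -->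
  bernstein_coef n f 1 *m invmx (bernstein_mx R n).
Proof.
rewrite -cvg_shiftS /=; under eq_fun do rewrite bernstein_coef_error.
set G := _ *m invmx _.
have := cvgD (cvg_cst G) (sub_bernstein_pow_cvg0 (bernstein_coef n f 1 - G)).
by rewrite addr0; apply.
Qed.

(** The first two eigenvalues equal 1, and the first two Newton polynomials are 1
    and X. *)
Lemma bernstein_comb_affine a b t :
  bernstein_comb (\row_(j < n.+1) (a + b * node R n j)) t = a + b * t.
Proof.
have -> : \row_(j < n.+1) (a + b * node R n j) =
    a *: node_row n (newton_poly R n 0) - (- b) *: node_row n (newton_poly R n 1).
  apply/rowP => j; rewrite !mxE !newton_poly_node /node.
  by rewrite ffactn0 ffactn1 expr0 expr1 divr1 mulr1 mulNr opprK.
have combZ c F : bernstein_comb (c *: F) t = c * bernstein_comb F t :> R.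
  by rewrite /bernstein_comb -scalemxAl mxE.
rewrite bernstein_combB !combZ !bernstein_comb_newton//.
rewrite /bernstein_eigenvalue ffactn0 ffactn1 expr0 expr1 divr1 divff//.
by rewrite expr0 expr1 !mul1r mulr1 mulNr opprK.
Qed.

End NewtonBasis.

Theorem theorem9 (R : realType) (n : nat) (hn : (0 < n)%N) (f : R -> R) :
  [/\ cvgn (bernstein_coef n f),
      bernstein_coef_lim n f = bernstein_coef n f 1 *m invmx (bernstein_mx R n),
      (forall t : R, 0 <= t <= 1 ->
         opt_bernstein n f t
         = (bernstein_coef n f 1 *m invmx (bernstein_mx R n)
            *m bernstein_vec n t) 0 0)
    & (forall a b : R, (forall t : R, 0 <= t <= 1 -> f t = a + b * t) ->
         forall t : R, 0 <= t <= 1 -> opt_bernstein n f t = f t)].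
Proof.
have lim_coef : bernstein_coef_lim n f =
    bernstein_coef n f 1 *m invmx (bernstein_mx R n).
  exact: (cvg_lim (@norm_hausdorff _ _) (bernstein_coef_cvg hn (f := f))).
split=> //; first by apply/cvg_ex; eexists; exact: bernstein_coef_cvg.
  by move=> t _; rewrite /opt_bernstein lim_coef.
move=> a b f_affine t t01; rewrite /opt_bernstein lim_coef.
have coef1 : bernstein_coef n f 1 = \row_(j < n.+1) (a + b * node R n j).
  rewrite bernstein_coef1//; apply/rowP => j; rewrite !mxE f_affine//.
  by rewrite divr_ge0//= ler_pdivrMr ?ltr0n// mul1r ler_nat -ltnS.
have fixed : bernstein_coef n f 1 *m bernstein_mx R n = bernstein_coef n f 1.
  by apply/rowP => j; rewrite bernstein_mulmx coef1 bernstein_comb_affine// mxE.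
rewrite -{1}fixed mulmxK ?bernstein_mx_unit// coef1.
by rewrite bernstein_comb_affine// f_affine.
Qed.
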